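(* For an integral domain $D$ the following are equivalent: (i) $D$ is a valuation domain; (ii) $D$ is a pre-Schreier $t$-local coherent domain; (iii) $D$ is a pre-Schreier $t$-local FC domain; (iv) $D$ is a pre-Schreier $t$-local $v$-FC domain; (v) $D$ is a GCD $t$-local domain.
   Context: Let $K$ be the quotient field of $D$. For a nonzero fractional ideal $E$ of $D$ put $E^{-1}=\{x\in K: xE\subseteq D\}$, $E^v=(E^{-1})^{-1}$, and $E^t=\bigcup\{F^v : F\subseteq E,\ F \text{ a nonzero finitely generated ideal}\}$; by convention $(0)^v=(0)^t=(0)$. $E$ is a $t$-ideal if $E=E^t$; it is a $v$-ideal of finite type if $E=E^v=F^v$ for some nonzero finitely generated fractional ideal $F\subseteq E$. ''Local'' means having exactly one maximal ideal (not necessarily Noetherian). An integral domain is $t$-local if it is local and its maximal ideal is a $t$-ideal (so a field is $t$-local). A nonzero element $r\in D$ is primal if for all $x,y\in D\setminus\{0\}$, $r\mid xy$ implies $r=st$ with $s\mid x$ and $t\mid y$; $D$ is pre-Schreier if every nonzero element is primal. A ring is coherent if every finitely generated ideal is finitely presented. $D$ is an FC (finite conductor) domain if the intersection of every pair of principal ideals of $D$ is finitely generated; a $v$-FC ($v$-finite conductor) domain if for all nonzero $a,b\in D$ the ideal $(a)\cap(b)$ is a $v$-ideal of finite type; a GCD domain if $aD\cap bD$ is principal for all $a,b\in D$. Fields are counted as valuation domains. *)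

(* Defs.v *)
From HB Require Import structures.
From mathcomp Require Import all_boot all_order all_algebra.
From mathcomp Require Import fraction ring_quotient.
From mathcomp Require Import boolp classical_sets.

Set Implicit Arguments.
Unset Strict Implicit.
Unset Printing Implicit Defensive.

Import GRing.Theory.
Local Open Scope ring_scope.
Local Open Scope classical_set_scope.

Section Domain.
Variable D : idomainType.

Local Notation K := {fraction D}.
Local Notation iota := (@tofrac D).

Definition divides (a b : D) : Prop := exists c, b = a * c.

Definition principal (a : D) : set D := [set x | divides a x].

Definition ideal_gen n (g : 'cV[D]_n) : set D :=
  range (fun c : 'rV[D]_n => (c *m g) 0 0).

Definition finitely_generated (I : set D) : Prop :=
  exists n (g : 'cV[D]_n), I = ideal_gen g.

(* Exactness of D^m -> D^n -> I -> 0, where the maps are given by A and g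
   acting on row vectors on the right. *)
Definition finitely_presented (I : set D) : Prop :=
  exists m n (A : 'M[D]_(m, n)) (g : 'cV[D]_n),
    I = ideal_gen g /\
    forall c : 'rV[D]_n, c *m g = 0 <-> exists d : 'rV[D]_m, c = d *m A.

Definition coherent : Prop :=
  forall I : set D, finitely_generated I -> finitely_presented I.

(* [idealr_closed] includes properness (1 is not in the ideal). *)
Definition maximal_ideal (M : set D) : Prop :=
  idealr_closed [in M] /\
  forall J : set D, idealr_closed [in J] -> M `<=` J -> J = M.

Definition frac_gen n (g : 'cV[K]_n) : set K :=
  range (fun c : 'rV[D]_n => (map_mx iota c *m g) 0 0).

Definition finitely_generated_frac (F : set K) : Prop :=
  exists n (g : 'cV[K]_n), F = frac_gen g.

(* The submodule {x | x E is contained in D} of K. *)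
Definition frac_inv (E : set K) : set K :=
  [set x | forall y, E y -> range iota (x * y)].

(* The zero case must be separated: when D is a field,
   frac_inv (frac_inv [set 0]) is all of K. *)
Definition v_closure (E : set K) : set K :=
  if `[< E = [set 0] >] then [set 0] else frac_inv (frac_inv E).

Definition t_closure (E : set K) : set K :=
  if `[< E = [set 0] >] then [set 0] else
  [set x | exists F : set K, [/\ finitely_generated_frac F, F <> [set 0],
                                 F `<=` E & v_closure F x]].

Definition t_ideal (E : set K) : Prop := E = t_closure E.

Definition v_ideal_of_finite_type (E : set K) : Prop :=
  exists F : set K, [/\ finitely_generated_frac F, F <> [set 0], F `<=` E,
                        E = v_closure E & E = v_closure F].

Definition t_local : Prop :=
  (exists! M : set D, maximal_ideal M) /\
  (forall M : set D, maximal_ideal M -> t_ideal (iota @` M)).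

Definition primal (r : D) : Prop :=
  forall x y : D, x != 0 -> y != 0 -> divides r (x * y) ->
  exists s t : D, [/\ r = s * t, divides s x & divides t y].

Definition pre_Schreier : Prop := forall r : D, r != 0 -> primal r.

Definition FC_domain : Prop :=
  forall a b : D, finitely_generated (principal a `&` principal b).

Definition v_FC_domain : Prop :=
  forall a b : D, a != 0 -> b != 0 ->
  v_ideal_of_finite_type (iota @` (principal a `&` principal b)).

Definition GCD_domain : Prop :=
  forall a b : D, exists c : D, principal a `&` principal b = principal c.

Definition valuation_domain : Prop :=
  forall x : K, x != 0 -> range iota x \/ range iota x^-1.

End Domain.

Arguments coherent : clear implicits.
Arguments t_local : clear implicits.
Arguments pre_Schreier : clear implicits.
Arguments FC_domain : clear implicits.
Arguments v_FC_domain : clear implicits.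
Arguments GCD_domain : clear implicits.
Arguments valuation_domain : clear implicits.

(* Main.v *)
Require Import Defs.
From mathcomp Require Import all_boot all_order all_algebra.
From mathcomp Require Import fraction ring_quotient generic_quotient.
From mathcomp Require Import ring.
From mathcomp Require Import boolp classical_sets.

(** Each condition implies the next one, cyclically, mostly by divisibility
    arguments inside [D].

    In a valuation domain divisibility is total.  Hence every finitely
    generated ideal is principal ([valuation_Bezout]), which gives coherence
    and makes every proper ideal a [t]-ideal; the nonunits form an ideal, which
    is then the only maximal one; and primality of [r] for the product [x y] is
    seen by comparing [r] with [x].

    Coherence makes the syzygies of [a] and [b] finitely generated
    ([coherent_syzygies]); multiplied by [a], their first components are the
    common multiples of [a] and [b].  This gives the finite conductor property,
    and the intersection of two nonzero principal ideals is always divisorial,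
    so the [v]-finite conductor property follows.

    The step to GCD domains rests on interpolation: in a pre-Schreier domain,
    if [a] and [b] divide each of finitely many elements, some [c] lies between
    them in the divisibility order ([pre_Schreier_interpolation]).  Applied to
    elements whose closure is the intersection of (a) and (b), it shows that
    this intersection is (c).

    Finally, in a GCD domain any two nonzero elements are [a = q e] and
    [b = p e] with [p] and [q] coprime.  The closure of the ideal (p, q)
    contains 1, so [p] and [q] cannot both lie in a maximal ideal that is a
    [t]-ideal ([t_ideal_no_coprime]).  By Zorn's lemma every nonunit
    lies in a maximal ideal ([nonunit_in_maximal]), and there is only one; so
    [p] or [q] is a unit, and one of [a] and [b] divides the other. *)

Set Implicit Arguments.
Unset Strict Implicit.
Unset Printing Implicit Defensive.

Import GRing.Theory.
Local Open Scope ring_scope.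
Local Open Scope classical_set_scope.

Local Notation iota := (@tofrac _).

(** * Divisibility and fractions *)

Lemma dividesxx (D : idomainType) (a : D) : divides a a.
Proof. by exists 1; rewrite mulr1. Qed.

Lemma divides0 (D : idomainType) (a : D) : divides a 0.
Proof. by exists 0; rewrite mulr0. Qed.

Lemma divides_mulr (D : idomainType) (a b : D) : divides a (a * b).
Proof. by exists b. Qed.

Lemma divides_trans (D : idomainType) (a b c : D) :
  divides a b -> divides b c -> divides a c.
Proof. by move=> [u ->] [v ->]; exists (u * v); rewrite mulrA. Qed.

Lemma divides_addMl (D : idomainType) (c a u v : D) :
  divides c u -> divides c v -> divides c (a * u + v).
Proof. by move=> [x ->] [y ->]; exists (a * x + y); rewrite mulrDr mulrCA. Qed.

Lemma fraction_quotient (D : idomainType) (x : {fraction D}) :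
  exists a b, b != 0 /\ x = iota a / iota b.
Proof.
elim/quotW: x => r; have d0 := denom_ratioP r.
exists (frac r).1, (frac r).2; split=> //.
suff <- : iota (frac r).2 * (\pi_({fraction D}) r)%qT = iota (frac r).1.
  by rewrite mulrAC divff ?mul1r // tofrac_eq0.
(* Both sides are now classes of explicit pairs, compared by cross products. *)
unlock tofrac; rewrite -[LHS]FracField.pi_mul; apply/eqmodP => /=.
rewrite FracField.equivfE /= /FracField.mulf !numden_Ratio ?oner_eq0 ?mul1r //.
by rewrite mulr1 mulrC.
Qed.

Lemma range_tofrac_div (D : idomainType) (a b : D) :
  b != 0 -> range iota (iota a / iota b) <-> divides b a.
Proof.
move=> b0; have Fb0 : iota b != 0 by rewrite tofrac_eq0.
split=> [[c _ eq_c]|[c ->]]; last first.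
  by exists c => //; rewrite tofracM mulrAC divff ?mul1r.
exists c; apply/eqP; rewrite -tofrac_eq tofracM eq_c mulrC.
by rewrite -mulrA mulVf ?mulr1.
Qed.

Lemma valuation_domainP (D : idomainType) :
  valuation_domain D <-> forall a b : D, divides a b \/ divides b a.
Proof.
split=> [valD a b | divD x x0].
  have [->|a0] := eqVneq a 0; first by right; exact: divides0.
  have [->|b0] := eqVneq b 0; first by left; exact: divides0.
  have := valD (iota a / iota b).
  rewrite mulf_neq0 ?invr_eq0 ?tofrac_eq0 // => /(_ isT).
  by rewrite invf_div => -[/range_tofrac_div|/range_tofrac_div];
    [right|left]; auto.
have [a [b [b0 xE]]] := fraction_quotient x.
have a0 : a != 0.
  by apply: contra_neq x0 => a0; rewrite xE a0 tofrac0 mul0r.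
rewrite xE invf_div.
by case: (divD a b); [right|left]; apply/range_tofrac_div.
Qed.

(** * Finitely generated ideals *)

Lemma ideal_gen0 (D : idomainType) n (g : 'cV[D]_n) : ideal_gen g 0.
Proof. by exists 0; rewrite // mul0mx mxE. Qed.

Lemma ideal_gen_entry (D : idomainType) n (g : 'cV[D]_n) i :
  ideal_gen g (g i 0).
Proof. by exists (delta_mx 0 i); rewrite // -rowE mxE. Qed.

Lemma sub_ideal_gen_principal (D : idomainType) n (g : 'cV[D]_n) (c : D) :
  (forall i, divides c (g i 0)) -> ideal_gen g `<=` principal c.
Proof.
move=> cg _ [r _ <-]; rewrite mxE.
apply: (big_ind (divides c)); first exact: divides0.
  by move=> x y cx cy; rewrite -[x]mul1r; apply: divides_addMl.
by move=> i _; have [u ->] := cg i; exists (r 0 i * u); rewrite mulrCA.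
Qed.

Lemma sub_principal_ideal_gen (D : idomainType) n (g : 'cV[D]_n) (c : D) :
  ideal_gen g c -> principal c `<=` ideal_gen g.
Proof.
move=> [r _ <-] _ [d ->]; exists (d *: r) => //.
by rewrite -scalemxAl mxE mulrC.
Qed.

Lemma principal_ideal_gen (D : idomainType) (c : D) :
  principal c = ideal_gen (c%:M : 'cV[D]_1).
Proof.
apply/seteqP; split.
  by apply: sub_principal_ideal_gen; exists 1%:M; rewrite // mul1mx mxE.
apply: sub_ideal_gen_principal => i.
by rewrite ord1 mxE; apply: dividesxx.
Qed.

(** In a domain the syzygies of one generator [c] are everything when [c = 0]
    and nothing otherwise, so they are generated by the scalar [(c == 0)]. *)
Lemma principal_finitely_presented (D : idomainType) (c : D) :
  finitely_presented (principal c).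
Proof.
exists 1%N, 1%N, ((c == 0)%:R%:M), (c%:M); split.
  exact: principal_ideal_gen.
move=> r; rewrite mul_mx_scalar; have [->|c0] := eqVneq c 0.
  rewrite scale0r; split=> // _.
  by exists r; rewrite mulmx1.
split=> [/eqP|[d ->]]; last by rewrite raddf0 mulmx0 scaler0.
rewrite scalemx_eq0 (negPf c0) /= => /eqP ->.
by exists 0; rewrite mul0mx.
Qed.

Lemma ideal_gen_factor (D : idomainType) m n (g : 'cV[D]_m) (h : 'cV[D]_n) :
  ideal_gen g `<=` ideal_gen h -> exists P : 'M_(m, n), g = P *m h.
Proof.
move=> gh; have /choice[r rE] i : exists r : 'rV[D]_n, (r *m h) 0 0 = g i 0.
  by have [r _ <-] := gh _ (ideal_gen_entry g i); exists r.
exists (\matrix_i r i); apply/matrixP => i j.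
by rewrite ord1 -rE -{1}(rowK r i) -row_mul mxE.
Qed.

(** Finite presentation does not depend on the generators: if [g = P h] and
    [h = Q g], the syzygies of [h] are generated by the rows of [1 - Q P] and
    of [A P], where the rows of [A] generate the syzygies of [g]. *)
Lemma coherent_syzygies (D : idomainType) n (h : 'cV[D]_n) : coherent D ->
  exists m (B : 'M[D]_(m, n)),
    forall c : 'rV_n, c *m h = 0 <-> exists d, c = d *m B.
Proof.
move=> cohD; have [|m [k [A [g [hg Ag]]]]] := cohD (ideal_gen h).
  by exists n, h.
have [P gE] : exists P : 'M_(k, n), g = P *m h.
  by apply: ideal_gen_factor; rewrite hg.
have [Q hE] : exists Q : 'M_(n, k), h = Q *m g.
  by apply: ideal_gen_factor; rewrite hg.
exists (n + m)%N, (col_mx (1%:M - Q *m P) (A *m P)) => c.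
split=> [ch0|[d ->]].
  have /Ag[d cQ] : c *m Q *m g = 0 by rewrite -mulmxA -hE.
  exists (row_mx c d); rewrite mul_row_col mulmxA -cQ.
  by rewrite mulmxBr mulmx1 mulmxA subrK.
rewrite -[d]hsubmxK mul_row_col mulmxDl -!mulmxA mulmxBl mul1mx.
rewrite -mulmxA -gE -hE subrr mulmx0 add0r mulmxA.
by apply/Ag; exists (rsubmx d).
Qed.

(** The common multiples of [a] and [b] are the products [a u] for the
    syzygies (u, v) of (a, b). *)
Lemma coherent_FC (D : idomainType) : coherent D -> FC_domain D.
Proof.
move=> cohD a b.
have [m [B BP]] := coherent_syzygies (col_mx a%:M b%:M : 'cV[D]_(1 + 1)) cohD.
exists m, (a *: lsubmx B); apply/seteqP; split=> [x [[u xu] [v xv]]|x [d _ <-]].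
  have /BP[d dE] : row_mx u%:M (- v)%:M *m
      (col_mx a%:M b%:M : 'cV[D]_(1 + 1)) = 0.
    by rewrite mul_row_col -!scalar_mxM -raddfD /= mulNr !(mulrC _ a)
      (mulrC v) -xu -xv subrr raddf0.
  exists d => //; rewrite -scalemxAr -[X in a *: X]/(d *m lsubmx B).
  have -> : d *m lsubmx B = u%:M.
    by rewrite -[RHS](row_mxKl _ (- v)%:M) dE -[in RHS](hsubmxK B) mul_mx_row
      row_mxKl.
  by rewrite !mxE xu.
have /BP : exists e, d *m B = e *m B by exists d.
rewrite -[B]hsubmxK mul_mx_row mul_row_col !mul_mx_scalar row_mxKl.
rewrite -scalemxAr.
move: (d *m lsubmx B) (d *m rsubmx B) => u v /matrixP/(_ 0 0).
rewrite !mxE => /eqP; rewrite addr_eq0 => /eqP syz.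
split; first by exists (u 0 0).
by exists (- v 0 0); rewrite syz mulrN.
Qed.

(** * Divisorial closures *)

Lemma neq_set1_0 (V : zmodType) (E : set V) x : E x -> x != 0 -> E <> [set 0].
Proof. by move=> Ex x0 E0; move: Ex x0; rewrite E0 => ->; rewrite eqxx. Qed.

Lemma v_closureE (D : idomainType) (E : set {fraction D}) :
  E <> [set 0] -> v_closure E = frac_inv (frac_inv E).
Proof. by move=> E0; rewrite /v_closure asboolF. Qed.

Lemma sub_v_closure (D : idomainType) (E : set {fraction D}) :
  E `<=` v_closure E.
Proof.
have [E0|E0] := EM (E = [set 0]); first by rewrite /v_closure asboolT // E0.
by rewrite v_closureE // => x Ex y /(_ x Ex); rewrite mulrC.
Qed.

(** Nonzero principal ideals are [v]-ideals: if [E] lies in (c) then [1/c]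
    belongs to the inverse of [E], so [x/c] is in [D] for [x] in the closure of
    [E]. *)
Lemma v_closure_sub_principal (D : idomainType) (E : set {fraction D}) (c : D) :
  c != 0 -> E `<=` iota @` principal c -> v_closure E `<=` iota @` principal c.
Proof.
move=> c0 Ec x; have [E0|E0] := EM (E = [set 0]).
  by rewrite /v_closure asboolT // => ->; exists 0; rewrite ?tofrac0 //;
    exact: divides0.
have Fc0 : iota c != 0 by rewrite tofrac_eq0.
rewrite v_closureE // => /(_ (iota c)^-1)[|d _ dE].
  by move=> y /Ec[_ [d ->] <-]; exists d; rewrite // tofracM mulKf.
exists (c * d); first exact: divides_mulr.
by rewrite tofracM dE mulrCA mulfV ?mulr1.
Qed.

Lemma frac_gen_tofrac (D : idomainType) n (h : 'cV[D]_n) :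
  frac_gen (map_mx iota h) = iota @` ideal_gen h.
Proof.
apply/seteqP; split=> [_ [r _ <-]|_ [_ [r _ <-] <-]].
  by exists ((r *m h) 0 0); [exists r|rewrite -map_mxM [RHS]mxE].
by exists r; rewrite // -map_mxM mxE.
Qed.

Lemma frac_gen_integral (D : idomainType) (F : set {fraction D}) :
  finitely_generated_frac F -> F `<=` range iota ->
  exists n (h : 'cV[D]_n), F = iota @` ideal_gen h.
Proof.
move=> [n [g ->]] gD.
have /choice[h hE] i : exists x : D, iota x = g i 0.
  have [|x _ xE] := gD (g i 0); last by exists x.
  exists (delta_mx 0 i); first by [].
  by rewrite map_delta_mx -rowE mxE.
exists n, (\col_i h i); rewrite -frac_gen_tofrac; congr frac_gen.
by apply/matrixP => i j; rewrite ord1 !mxE hE.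
Qed.

Lemma idealr_closedP (D : idomainType) (I : set D) :
  idealr_closed [in I] <->
  [/\ I 0, ~ I 1 & forall a u v, I u -> I v -> I (a * u + v)].
Proof.
split=> [[I0 I1 IM]|[I0 I1 IM]]; split.
- by rewrite inE in I0.
- by move=> /mem_set; apply/negP.
- by move=> a u v /mem_set Iu /mem_set Iv; apply/set_mem/IM.
- exact: mem_set.
- by apply/negP => /set_mem.
- by move=> a u v /set_mem Iu /set_mem Iv; apply/mem_set/IM.
Qed.

Lemma principal_sub_ideal (D : idomainType) (I : set D) (x : D) :
  idealr_closed [in I] -> I x -> principal x `<=` I.
Proof.
move=> /idealr_closedP[I0 _ IM] Ix _ [d ->].
by rewrite -[x * d]addr0 mulrC; apply: IM.
Qed.

(** An element [x] of [I] lies in the closure of the ideal it generates; if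
    [x = 0] but [I] is nonzero, a nonzero [y] in [I] takes its place. *)
Lemma sub_t_closure (D : idomainType) (I : set D) : idealr_closed [in I] ->
  iota @` I `<=` t_closure (iota @` I).
Proof.
move=> idI; have [I0 _ _] := (idealr_closedP I).1 idI.
have [E0|E0] := EM (iota @` I = [set 0]).
  by rewrite /t_closure asboolT // E0.
rewrite /t_closure asboolF // => _ [x Ix <-].
have [y [Iy y0 yx]] : exists y, [/\ I y, y != 0 & divides y x].
  have [x0|x0] := eqVneq x 0; last by exists x; split=> //; exact: dividesxx.
  apply: contrapT => noy; apply: E0; apply/seteqP; split=> [_ [y Iy <-]|_ ->].
    have [->|y0] := eqVneq y 0; first exact: tofrac0.
    by case: noy; exists y; split=> //; rewrite x0; exact: divides0.
  by exists 0; rewrite ?tofrac0.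
exists (iota @` principal y); split.
- exists 1%N, (map_mx iota y%:M).
  by rewrite frac_gen_tofrac principal_ideal_gen.
- apply: (@neq_set1_0 _ _ (iota y)); last by rewrite tofrac_eq0.
  by exists y => //; exact: dividesxx.
- by apply: image_subset; apply: principal_sub_ideal.
- by apply: sub_v_closure; exists x.
Qed.

(** * Maximal ideals *)

(** Zorn's lemma is applied to the proper ideals containing [x] together with
    the empty set, which serves as the union of the empty chain. *)
Lemma nonunit_in_maximal (D : idomainType) (x : D) :
  ~ divides x 1 -> exists2 M : set D, maximal_ideal M & M x.
Proof.
move=> xNunit.
pose P (I : set D) := I = set0 \/ idealr_closed [in I] /\ I x.
have [F FP totF|M [PM maxM]] := @Zorn_bigcup _ P.
  have FI I y : F I -> I y -> idealr_closed [in I] /\ I x.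
    by move=> FI Iy; case: (FP I FI) => // I0; rewrite I0 in Iy.
  have [[I [FI0 [y Iy]]]|F0] := EM (exists I, F I /\ I !=set0); last first.
    left; apply/seteqP; split=> // y [I FI0 Iy]; case: F0.
    by exists I; split=> //; exists y.
  right; have [/idealr_closedP[I0 _ _] Ix] := FI _ _ FI0 Iy.
  split; last by exists I.
  apply/idealr_closedP; split; first by exists I.
    by move=> [J FJ J1]; have [/idealr_closedP[]] := FI _ _ FJ J1.
  move=> a u v [J FJ Ju] [L FL Lv].
  have [/idealr_closedP[_ _ JM] _] := FI _ _ FJ Ju.
  have [/idealr_closedP[_ _ LM] _] := FI _ _ FL Lv.
  have [JL|LJ] := totF J L FJ FL.
    by exists L => //; apply: LM => //; apply: JL.
  by exists J => //; apply: JM => //; apply: LJ.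
have idx : P (principal x).
  right; split; last exact: dividesxx.
  apply/idealr_closedP; split=> //; first exact: divides0.
  by move=> a u v; apply: divides_addMl.
case: PM => [M0|[idM Mx]].
  case: (maxM _ _ idx); rewrite M0; split; first by [].
  by move=> /(_ x (dividesxx x)).
exists M => //; split=> // J idJ MJ; apply: contrapT => JM.
apply: (maxM J); last by right; split=> //; apply: MJ.
by split=> // JsubM; apply: JM; apply/seteqP.
Qed.

(** Every proper ideal consists of nonunits, so the nonunits form the only
    maximal ideal as soon as they form an ideal. *)
Lemma maximal_ideal_nonunits (D : idomainType) (M : set D) :
  idealr_closed [in [set x : D | ~ divides x 1]] ->
  maximal_ideal M <-> M = [set x : D | ~ divides x 1].
Proof.
have sub (J : set D) : idealr_closed [in J] -> J `<=` [set x | ~ divides x 1].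
  move=> idJ x Jx x1; have [_ + _] := (idealr_closedP J).1 idJ.
  by apply; apply: (principal_sub_ideal idJ Jx).
move=> idN; split=> [[idM maxM]|->].
  by rewrite (maxM _ idN) //; apply: sub.
by split=> // J idJ NJ; apply/seteqP; split=> //; apply: sub.
Qed.

(** * Valuation domains *)

Lemma valuation_pre_Schreier (D : idomainType) :
  valuation_domain D -> pre_Schreier D.
Proof.
move=> /valuation_domainP divD r r0 x y x0 _ rxy.
have [rx|[s rE]] := divD r x.
  by exists r, 1; split; [rewrite mulr1|exact: rx|exists y; rewrite mul1r].
exists x, s; split=> //; first exact: dividesxx.
case: rxy => d; rewrite rE -mulrA => /(mulfI x0) ->.
exact: divides_mulr.
Qed.

Lemma valuation_Bezout (D : idomainType) n (g : 'cV[D]_n) :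
  valuation_domain D -> exists2 c, ideal_gen g c & ideal_gen g = principal c.
Proof.
move=> /valuation_domainP divD.
have [c cs cdiv] : exists2 c, c \in 0 :: codom (g^~ 0) &
    forall x, x \in codom (g^~ 0) -> divides c x.
  (* Everything divides 0, so the search starts there; [c] is
     replaced by [x] whenever [x] divides [c]. *)
  elim: (codom _) => [|x s [c cs cdiv]]; first by exists 0; rewrite ?mem_head.
  have [xc|cx] := divD x c.
    exists x; first by rewrite !inE eqxx orbT.
    move=> y; rewrite inE => /orP[/eqP ->|/cdiv]; first exact: dividesxx.
    exact: divides_trans.
  exists c.
    by move: cs; rewrite !inE => /orP[->|cs] //; rewrite cs !orbT.
  by move=> y; rewrite inE => /orP[/eqP ->|/cdiv].
have gc : ideal_gen g c.
  move: cs; rewrite inE => /orP[/eqP ->|/codomP[i ->]]; first exact: ideal_gen0.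
  exact: ideal_gen_entry.
exists c => //; apply/seteqP; split; last exact: sub_principal_ideal_gen.
by apply: sub_ideal_gen_principal => i; apply/cdiv/codom_f.
Qed.

Lemma valuation_coherent (D : idomainType) : valuation_domain D -> coherent D.
Proof.
move=> valD _ [n [g ->]]; have [c _ ->] := valuation_Bezout g valD.
exact: principal_finitely_presented.
Qed.

Lemma valuation_nonunits (D : idomainType) : valuation_domain D ->
  idealr_closed [in [set x : D | ~ divides x 1]].
Proof.
move=> /valuation_domainP divD; apply/idealr_closedP; split.
- by move=> [d /eqP]; rewrite mul0r oner_eq0.
- by apply; exact: dividesxx.
- move=> a u v uN vN w1; have [uv|vu] := divD u v.
    by apply: uN; apply: divides_trans w1; apply: divides_addMl => //;
      exact: dividesxx.
  by apply: vN; apply: divides_trans w1; apply: divides_addMl => //;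
    exact: dividesxx.
Qed.

(** Finitely generated ideals are principal, hence divisorial, so the closures
    whose union is the [t]-closure of [I] all lie in [I]. *)
Lemma valuation_t_ideal (D : idomainType) (I : set D) : valuation_domain D ->
  idealr_closed [in I] -> t_ideal (iota @` I).
Proof.
move=> valD idI; apply/seteqP; split; first exact: sub_t_closure.
move=> x; rewrite /t_closure; case: asboolP => [-> //|_].
move=> [F [Ffg F0 FI Fx]].
have [|n [h FE]] := frac_gen_integral Ffg.
  by move=> y /FI[z _ <-]; exists z.
have [c hc hE] := valuation_Bezout h valD; rewrite hE in FE.
have c0 : c != 0.
  apply: contra_not_neq F0 => c0; rewrite FE c0; apply/seteqP; split.
    by move=> _ [_ [d ->] <-]; rewrite mul0r tofrac0.
  by move=> _ ->; exists 0; rewrite ?tofrac0 //; exact: divides0.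
have [z cz <-] : (iota @` principal c) x.
  by apply: v_closure_sub_principal Fx; rewrite ?FE.
exists z => //; apply: principal_sub_ideal cz => //.
have [|y Iy /eqP] := FI (iota c).
  by rewrite FE; exists c => //; exact: dividesxx.
by rewrite tofrac_eq => /eqP <-.
Qed.

Lemma valuation_t_local (D : idomainType) : valuation_domain D -> t_local D.
Proof.
move=> valD; have idN := valuation_nonunits valD.
split; last by move=> M [idM _]; apply: valuation_t_ideal.
exists [set x : D | ~ divides x 1]; split; first exact/maximal_ideal_nonunits.
by move=> M /(maximal_ideal_nonunits _ idN).
Qed.

(** * From finite conductors to greatest common divisors *)

(** The closure of the intersection of (a) and (b) lies in (a) and in (b), so
    the intersection is divisorial. *)
Lemma FC_v_FC (D : idomainType) : FC_domain D -> v_FC_domain D.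
Proof.
move=> fcD a b a0 b0; have [n [g gE]] := fcD a b.
set E := iota @` _.
have E0 : E <> [set 0].
  apply: (@neq_set1_0 _ _ (iota (a * b))); last by rewrite tofrac_eq0 mulf_neq0.
  exists (a * b) => //; split; first exact: divides_mulr.
  by rewrite /principal /= mulrC; exact: divides_mulr.
have Ev : E = v_closure E.
  apply/seteqP; split=> [|x Ex]; first exact: sub_v_closure.
  have [|y ay yx] := v_closure_sub_principal a0 _ Ex.
    by apply: image_subset => y [].
  have [|z bz zx] := v_closure_sub_principal b0 _ Ex.
    by apply: image_subset => z [].
  exists y => //; split=> //.
  by move/eqP: yx; rewrite -zx tofrac_eq => /eqP ->.
exists E; split=> //.
by exists n, (map_mx iota g); rewrite frac_gen_tofrac -gE.
Qed.

(** Since [b] divides [x = a (x/a)], write [b = s t] with [s] dividing [a] and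
    [t] dividing [x/a].  Since [b] divides [y], [t] divides [(a/s) (y/a)]; so
    [t = t1 t2] with [t1] dividing [a/s] and [t2] dividing [y/a].  The
    interpolated element is [a t2], a multiple of [b = s t1 t2] because
    [s t1] divides [a]. *)
Lemma pre_Schreier_interpolation2 (D : idomainType) (a b x y : D) :
    pre_Schreier D -> a != 0 -> b != 0 ->
    divides a x -> divides b x -> divides a y -> divides b y ->
  exists c, [/\ divides a c, divides b c, divides c x & divides c y].
Proof.
move=> psD a0 b0 ax bx ay byy.
have [x0|x0] := eqVneq x 0; first by exists y; split=> //;
  [rewrite x0; exact: divides0 | exact: dividesxx].
have [y0|y0] := eqVneq y 0; first by exists x; split=> //;
  [exact: dividesxx | rewrite y0; exact: divides0].
case: ax ay => [x' xE] [y' yE]; rewrite {x}xE {y}yE in x0 y0 bx byy *.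
have x'0 : x' != 0 by apply: contra_neq x0 => ->; rewrite mulr0.
have y'0 : y' != 0 by apply: contra_neq y0 => ->; rewrite mulr0.
have [s [t [bE [a' aE] tx']]] := psD b b0 a x' a0 x'0 bx.
move: b0; rewrite bE mulf_eq0 negb_or => /andP[s0 t0].
have a'0 : a' != 0 by apply: contra_neq a0 => a'0; rewrite aE a'0 mulr0.
have ty : divides t (a' * y').
  case: byy => d; rewrite bE aE -!mulrA => /(mulfI s0) ->.
  exact: divides_mulr.
have [t1 [t2 [tE [a'' a'E] [y'' y'E]]]] := psD t t0 a' y' a'0 y'0 ty.
exists (a * t2); split.
- exact: divides_mulr.
- by exists a''; rewrite tE aE a'E -!mulrA (mulrC a'').
- by case: tx' => x'' ->; exists (t1 * x''); rewrite tE -!mulrA (mulrCA t1).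
- by exists y''; rewrite y'E mulrA.
Qed.

Lemma pre_Schreier_interpolation (D : idomainType) (a b : D) (s : seq D) :
    pre_Schreier D -> a != 0 -> b != 0 ->
    (forall x, x \in s -> divides a x /\ divides b x) ->
  exists c, [/\ divides a c, divides b c & forall x, x \in s -> divides c x].
Proof.
move=> psD a0 b0; elim: s => [_|x s IHs abs].
  by exists 0; split=> //; exact: divides0.
have [ax bx] := abs x (mem_head x s).
have [y ys|c [ac bc cs]] := IHs; first by apply: abs; rewrite inE ys orbT.
have [d [ad bd dx dc]] := pre_Schreier_interpolation2 psD a0 b0 ax bx ac bc.
exists d; split=> // y; rewrite inE => /orP[/eqP -> //|/cs].
exact: divides_trans.
Qed.

(** If the intersection of (a) and (b) is the closure of [F], an element [c]
    interpolated between [a], [b] and the generators of [F] belongs to this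
    intersection, while (c) contains [F] and hence its closure. *)
Lemma pre_Schreier_v_FC_GCD (D : idomainType) :
  pre_Schreier D -> v_FC_domain D -> GCD_domain D.
Proof.
move=> psD fcD a b.
have [a0|a0] := eqVneq a 0.
  exists 0; rewrite a0; apply: setIidl => _ [d ->].
  by rewrite mul0r; exact: divides0.
have [b0|b0] := eqVneq b 0.
  exists 0; rewrite b0; apply: setIidr => _ [d ->].
  by rewrite mul0r; exact: divides0.
have [F [Ffg F0 Fab _ abE]] := fcD a b a0 b0.
have [|n [h FE]] := frac_gen_integral Ffg.
  by move=> y /Fab[z _ <-]; exists z.
have [x /codomP[i ->]|c [ac bc ch]] :=
    pre_Schreier_interpolation (s := codom (h^~ 0)) psD a0 b0.
  have [|y [ay byy] /eqP] := Fab (iota (h i 0)).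
    by rewrite FE; exists (h i 0) => //; exact: ideal_gen_entry.
  by rewrite tofrac_eq => /eqP <-.
have hc : ideal_gen h `<=` principal c.
  by apply: sub_ideal_gen_principal => i; apply/ch/codom_f.
have c0 : c != 0.
  apply: contra_not_neq F0 => c0; rewrite FE; apply/seteqP; split.
    by move=> _ [_ /hc[d ->] <-]; rewrite c0 mul0r tofrac0.
  by move=> _ ->; exists 0; rewrite ?tofrac0 //; exact: ideal_gen0.
exists c; apply/seteqP; split=> [x abx|x cx]; last first.
  by split; apply: divides_trans cx.
have : v_closure F (iota x) by rewrite -abE; exists x.
move=> /(v_closure_sub_principal c0)[|y cy /eqP].
  by rewrite FE; apply: image_subset.
by rewrite tofrac_eq => /eqP <-.
Qed.

(** * GCD domains with a [t]-maximal ideal *)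

(** When every common multiple of [p] and [q] is a multiple of [p q], the
    inverse of the ideal (p, q) is [D]: for [y] in it, [y p q] is a multiple of
    [p] and of [q], hence of [p q].  So 1 lies in the closure of (p, q). *)
Lemma t_ideal_no_coprime (D : idomainType) (I : set D) (p q : D) :
    idealr_closed [in I] -> t_ideal (iota @` I) -> p != 0 -> q != 0 ->
    (forall z, divides p z -> divides q z -> divides (p * q) z) ->
  I p -> I q -> False.
Proof.
move=> idI tI p0 q0 pq Ip Iq; have [I0 I1 IM] := (idealr_closedP I).1 idI.
have Fp0 : iota p != 0 by rewrite tofrac_eq0.
have nz (J : set D) : J p -> iota @` J <> [set 0].
  by move=> Jp; apply: (@neq_set1_0 _ _ (iota p)) => //; exists p.
pose h : 'cV[D]_(1 + 1) := col_mx p%:M q%:M.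
have hp : ideal_gen h p.
  by have := ideal_gen_entry h (lshift 1 0); rewrite col_mxEu mxE.
have hq : ideal_gen h q.
  by have := ideal_gen_entry h (rshift 1 0); rewrite col_mxEd mxE.
have : t_closure (iota @` I) (iota 1).
  rewrite /t_closure asboolF; last exact: nz.
  exists (iota @` ideal_gen h); split.
  - by exists 2%N, (map_mx iota h); rewrite frac_gen_tofrac.
  - exact: nz.
  - apply: image_subset => _ [r _ <-].
    rewrite -[r]hsubmxK mul_row_col !mul_mx_scalar !mxE.
    rewrite mulrC; apply: (IM) => //.
    by apply: (principal_sub_ideal idI Iq); exact: divides_mulr.
  - rewrite v_closureE; last exact: nz.
    move=> y yh; rewrite tofrac1 mul1r.
    have [|u _ uE] := yh (iota p); first by exists p.
    have [|w _ wE] := yh (iota q); first by exists q.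
    have uwE : u * q = p * w.
      by apply/eqP; rewrite -tofrac_eq !tofracM uE wE mulrCA mulrA.
    have [||d] := pq (u * q); first by rewrite uwE; exact: divides_mulr.
      by rewrite mulrC; exact: divides_mulr.
    rewrite [u * q]mulrC [p * q]mulrC -mulrA => /(mulfI q0) uE'.
    exists d => //; apply: (mulfI Fp0).
    by rewrite -tofracM -uE' uE mulrC.
by rewrite -tI => -[x Ix /eqP]; rewrite tofrac_eq => /eqP x1; rewrite x1 in Ix.
Qed.

(** If (c) is the intersection of (a) and (b), write [c = a p = b q] and
    [a b = c e], so that [a = q e] and [b = p e], where every common multiple
    of [p] and [q] is a multiple of [p q]. *)
Lemma GCD_t_local_valuation (D : idomainType) :
  GCD_domain D -> t_local D -> valuation_domain D.
Proof.
move=> gcdD [[M [_ uniqM]] tM]; apply/valuation_domainP => a b.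
have [->|a0] := eqVneq a 0; first by right; exact: divides0.
have [->|b0] := eqVneq b 0; first by left; exact: divides0.
have [c cE] := gcdD a b.
have abP x : divides a x -> divides b x -> divides c x.
  move=> ax bx; suff : principal c x by [].
  by rewrite -cE.
have [[p pE] [q qE]] : (principal a `&` principal b) c.
  by rewrite cE; exact: dividesxx.
have [e eE] : divides c (a * b).
  by apply: abP; [|rewrite mulrC]; exact: divides_mulr.
have bE : b = p * e by apply: (mulfI a0); rewrite eE pE mulrA.
have aE : a = q * e by apply: (mulfI b0); rewrite mulrC eE qE mulrA.
have p0 : p != 0 by apply: contra_neq b0 => p0; rewrite bE p0 mul0r.
have q0 : q != 0 by apply: contra_neq a0 => q0; rewrite aE q0 mul0r.
have e0 : e != 0 by apply: contra_neq a0 => e0; rewrite aE e0 mulr0.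
have pqP z : divides p z -> divides q z -> divides (p * q) z.
  move=> [u uE] [w wE].
  have [||k kE] := abP (e * z).
  - by rewrite wE aE mulrA (mulrC e); exact: divides_mulr.
  - by rewrite uE bE mulrA (mulrC e); exact: divides_mulr.
  by exists k; apply: (mulfI e0); rewrite kE pE aE; ring.
have [[p' p1]|pN] := EM (divides p 1).
  right; exists (q * p'); apply: (mulfI p0).
  by rewrite mulrC -pE qE mulrCA !mulrA mulrAC -(mulrA _ p) -p1 mulr1.
have [[q' q1]|qN] := EM (divides q 1).
  left; exists (p * q'); apply: (mulfI q0).
  by rewrite mulrC -qE pE mulrCA !mulrA mulrAC -(mulrA _ q) -q1 mulr1.
have [N maxN Np] := nonunit_in_maximal pN.
have [N' maxN' N'q] := nonunit_in_maximal qN.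
rewrite -(uniqM _ maxN') (uniqM _ maxN) in N'q.
by have := t_ideal_no_coprime maxN.1 (tM N maxN) p0 q0 pqP Np N'q.
Qed.

Theorem corollary5p7 (D : idomainType) :
  [<-> valuation_domain D;
       [/\ pre_Schreier D, t_local D & coherent D];
       [/\ pre_Schreier D, t_local D & FC_domain D];
       [/\ pre_Schreier D, t_local D & v_FC_domain D];
       GCD_domain D /\ t_local D].
Proof.
tfae.
- move=> valD; split; first exact: valuation_pre_Schreier.
    exact: valuation_t_local.
  exact: valuation_coherent.
- by move=> [psD tlD /coherent_FC].
- by move=> [psD tlD /FC_v_FC].
- by move=> [psD tlD fcD]; split=> //; exact: pre_Schreier_v_FC_GCD.
- by move=> [gcdD tlD]; exact: GCD_t_local_valuation.
Qed.
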